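(* Let $G$ be a group and let $H$ be a subgroup of $G$. The pair $(G,H)$ is essentially surjective if and only if for each subgroup $K$ of $H$ there exists a subgroup $L$ of $G$ such that: (i) $G=LH$ and (ii) $L\cap H=K$.
   Context: Groups and group sets are not necessarily finite. For a group $G$, $G\text{-}\mathbf{set}$ denotes the category of right $G$-sets with $G$-equivariant functions as morphisms. Let $\iota:H\hookrightarrow G$ be the inclusion and let $\iota^{\ast}:G\text{-}\mathbf{set}\to H\text{-}\mathbf{set}$ be the functor restricting the $G$-action to $H$. The pair $(G,H)$ is called essentially surjective provided $\iota^{\ast}$ is essentially surjective, i.e., every $H$-set is isomorphic to $\iota^{\ast}(S)$ for some $G$-set $S$. $LH:=\{lh\mid l\in L,\ h\in H\}$. *)

(* Defs.v *)
From HB Require Import structures.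
From mathcomp Require Import all_boot boolp classical_sets.

Set Implicit Arguments.
Unset Strict Implicit.
Unset Printing Implicit Defensive.

Local Open Scope group_scope.

Section SubgroupType.
Variables (G : groupType) (H : groupClosed G).

(* A [groupClosed G] has boolean membership; under the axioms of [boolp] every
   Prop-valued subgroup of G is of this form, so no subgroup is excluded. *)
Record subgroup_type : Type :=
  Subgroup { subgroup_incl : G; _ : subgroup_incl \in H }.

HB.instance Definition _ := [isSub for subgroup_incl].
HB.instance Definition _ := [Choice of subgroup_type by <:].

Fact subgroup_group_closed : group_closed (fun x => x \in H).
Proof. by split=> [|x y]; [exact: gpred1 | exact: gpredF]. Qed.

HB.instance Definition _ :=
  SubChoice_isSubGroup.Build G _ subgroup_type subgroup_group_closed.

End SubgroupType.

(* Right G-sets, on an arbitrary carrier type with Leibniz equality. *)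
Record gset (G : groupType) := GSet {
  gset_sort :> Type;
  gset_act : gset_sort -> G -> gset_sort;
  _ : forall x, gset_act x 1 = x;
  _ : forall x g h, gset_act x (g * h) = gset_act (gset_act x g) h
}.

Definition equivariant (G : groupType) (X Y : gset G) (f : X -> Y) : Prop :=
  forall x g, f (gset_act x g) = gset_act (f x) g.

(* Isomorphism in G-set: a pair of mutually inverse morphisms. *)
Definition gset_iso (G : groupType) (X Y : gset G) : Prop :=
  exists (f : X -> Y) (f' : Y -> X),
    [/\ equivariant f, equivariant f', cancel f f' & cancel f' f].

(* The functor from G-set to H-set, on objects; it is the identity on the
   underlying functions of morphisms. *)
Section Restriction.
Variables (G : groupType) (H : groupClosed G) (S : gset G).

Definition restr_act (x : S) (h : subgroup_type H) : S := gset_act x (val h).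

Fact restr_act1 x : restr_act x 1 = x.
Proof. by rewrite /restr_act val1; case: S x. Qed.

Fact restr_actM x g h : restr_act x (g * h) = restr_act (restr_act x g) h.
Proof. by rewrite /restr_act valM; case: S x. Qed.

Definition restr_gset : gset (subgroup_type H) := GSet restr_act1 restr_actM.

End Restriction.

Definition essentially_surjective (G : groupType) (H : groupClosed G) : Prop :=
  forall X : gset (subgroup_type H),
    exists S : gset G, gset_iso X (restr_gset H S).

(* Main.v *)
(* Given an H-set X, the group action is extended to G on X itself: in each
   H-orbit pick a point r and a subgroup L with G = LH and L :&: H the
   stabilizer of r in H, and set (r h) g := r h' where h g = l h' with l in L.
   The element h' is determined up to left multiplication by L :&: H, so r h'
   is well defined.  Conversely, given K, extend the H-set of right cosets of K
   to a G-set and let L be the stabilizer in G of the trivial coset. *)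
Require Import Defs.
From HB Require Import structures.
From mathcomp Require Import all_boot boolp classical_sets.

Local Open Scope group_scope.
Local Open Scope classical_set_scope.

(** * Orbits, stabilizers and right translation of subsets *)

Section GSetTheory.
Context {G : groupType}.
Implicit Types (X : gset G) (g : G).

Lemma gset_act1 X (x : X) : gset_act x 1 = x.
Proof. by case: X x. Qed.

Lemma gset_actM X (x : X) g h : gset_act x (g * h) = gset_act (gset_act x g) h.
Proof. by case: X x. Qed.

Lemma gset_actK X g : cancel (fun x : X => gset_act x g) (fun x => gset_act x g^-1).
Proof. by move=> x; rewrite -gset_actM mulgV gset_act1. Qed.

Lemma gset_act_eq X (x : X) g h :
  gset_act x g = gset_act x h <-> gset_act x (g / h) = x.
Proof.
split=> [e|e]; first by rewrite gset_actM e gset_actK.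
by rewrite -{2}e -gset_actM mulgVK.
Qed.

Definition stabilizer X (x : X) : {pred G} := fun g => `[< gset_act x g = x >].

Lemma stabilizerP X (x : X) g : g \in stabilizer X x <-> gset_act x g = x.
Proof. by rewrite unfold_in; split=> /asboolP. Qed.

Fact stabilizer_mul_closed X (x : X) : mulg_closed (stabilizer X x).
Proof.
move=> g h /stabilizerP eg /stabilizerP eh.
by apply/stabilizerP; rewrite gset_actM eg eh.
Qed.

Fact stabilizer1 X (x : X) : 1 \in stabilizer X x.
Proof. by apply/stabilizerP; rewrite gset_act1. Qed.

Fact stabilizer_inv_closed X (x : X) : invg_closed (stabilizer X x).
Proof. by move=> g /stabilizerP eg; apply/stabilizerP; rewrite -{1}eg gset_actK. Qed.

HB.instance Definition _ X (x : X) :=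
  isMulClosed.Build G (stabilizer X x) (stabilizer_mul_closed X x).
HB.instance Definition _ X (x : X) :=
  isMul1Closed.Build G (stabilizer X x) (stabilizer1 X x).
HB.instance Definition _ X (x : X) :=
  isInvClosed.Build G (stabilizer X x) (stabilizer_inv_closed X x).

Definition orbit X (x : X) : set X := [set y | exists g, y = gset_act x g].

Lemma orbit_refl X (x : X) : orbit X x x.
Proof. by exists 1; rewrite gset_act1. Qed.

Lemma orbit_act_closed X (x y : X) g : orbit X x y -> orbit X x (gset_act y g).
Proof. by move=> [h ->]; exists (h * g); rewrite gset_actM. Qed.

Lemma orbit_act X (x : X) g : orbit X (gset_act x g) = orbit X x.
Proof.
apply/seteqP; split=> y [h ->]; first by exists (g * h); rewrite gset_actM.
by exists (g^-1 * h); rewrite -gset_actM mulVKg.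
Qed.

(** The choice depends on [x] only through the set [orbit X x], up to an irrelevant proof of
    nonemptiness, so it is constant on orbits. *)
Definition orbit_repr X (x : X) : X := 
  sval (@cid _ (orbit X x) (ex_intro _ x (orbit_refl X x))).

Lemma orbit_repr_act X (x : X) g : orbit_repr X (gset_act x g) = orbit_repr X x.
Proof.
rewrite /orbit_repr.
(* The nonemptiness proofs mention the orbits in their types; once they are generalized, the two
   equal orbits can be identified. *)
move: (ex_intro _ (gset_act x g) _) (ex_intro _ x _); rewrite orbit_act => p q.
by rewrite (Prop_irrelevance p q).
Qed.

Lemma orbit_reprP X (x : X) : exists g, x = gset_act (orbit_repr X x) g.
Proof.
rewrite /orbit_repr; case: cid => y /= [g ->].
by exists g^-1; rewrite gset_actK.
Qed.

Lemma orbit_repr_id X (x : X) : orbit_repr X (orbit_repr X x) = orbit_repr X x.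
Proof. by have [g e] := orbit_reprP X x; rewrite [in RHS]e orbit_repr_act. Qed.

Section OrbitGSet.
Variables (X : gset G) (x : X).

Definition orbit_gset_act (y : {y | orbit X x y}) g : {y | orbit X x y} :=
  exist _ (gset_act (sval y) g) (orbit_act_closed _ _ _ g (svalP y)).

Lemma orbit_sval_inj : injective (sval : {y | orbit X x y} -> X).
Proof. by move=> [y py] [z pz] /= e; subst z; rewrite (Prop_irrelevance py pz). Qed.

Fact orbit_gset_act1 y : orbit_gset_act y 1 = y.
Proof. by apply: orbit_sval_inj; rewrite /= gset_act1. Qed.

Fact orbit_gset_actM y g h :
  orbit_gset_act y (g * h) = orbit_gset_act (orbit_gset_act y g) h.
Proof. by apply: orbit_sval_inj; rewrite /= gset_actM. Qed.

Definition orbit_gset : gset G :=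
  @GSet G _ orbit_gset_act orbit_gset_act1 orbit_gset_actM.

End OrbitGSet.

(** This is the set [A g]; for a subgroup [A] the translates are its right cosets. *)
Definition translate (A : set G) g : set G := [set y | A (y / g)].

Fact translate1 A : translate A 1 = A.
Proof. by apply/funext => y; rewrite /translate /= divg1. Qed.

Fact translateM A g h : translate A (g * h) = translate (translate A g) h.
Proof. by apply/funext => y; rewrite /translate /= invgM mulgA. Qed.

Definition powerset_gset : gset G :=
  @GSet G _ translate translate1 translateM.

(** Evaluating the equality of sets at [g] gives the direct implication, since [g / g = 1]. So [K]
    is its own stabilizer under right translation. *)
Lemma translate_group (K : groupClosed G) g :
  translate [set` K] g = [set` K] <-> g \in K.
Proof.
split=> [/(congr1 (fun A : set G => A g))|gK].
  by rewrite /translate /= mulgV => <-; exact: gpred1.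
by apply/seteqP; split=> y; rewrite /translate /= gpredFr.
Qed.

End GSetTheory.

(** * Transfer of subgroups between [G] and [subgroup_type H] *)

Section SubgroupPredicates.
Context {G : groupType} {H : groupClosed G}.

Definition subgroup_preim (K : groupClosed G) : {pred subgroup_type H} :=
  fun h => val h \in K.

Lemma mem_subgroup_preim K h : (h \in subgroup_preim K) = (val h \in K).
Proof. by []. Qed.

Fact subgroup_preim_mul_closed K : mulg_closed (subgroup_preim K).
Proof. by move=> g h; rewrite !mem_subgroup_preim valM => gK hK; rewrite gpredMr. Qed.

Fact subgroup_preim1 K : 1 \in subgroup_preim K.
Proof. by rewrite mem_subgroup_preim val1 gpred1. Qed.

Fact subgroup_preim_inv_closed K : invg_closed (subgroup_preim K).
Proof. by move=> g; rewrite !mem_subgroup_preim gmulfV gpredV. Qed.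

HB.instance Definition _ K := isMulClosed.Build _ (subgroup_preim K)
  (subgroup_preim_mul_closed K).
HB.instance Definition _ K := isMul1Closed.Build _ (subgroup_preim K)
  (subgroup_preim1 K).
HB.instance Definition _ K := isInvClosed.Build _ (subgroup_preim K)
  (subgroup_preim_inv_closed K).

Definition subgroup_image (K : groupClosed (subgroup_type H)) : {pred G} :=
  fun g => `[< exists2 h : subgroup_type H, h \in K & g = val h >].

Lemma subgroup_imageP K (g : G) :
  g \in subgroup_image K <-> exists2 h : subgroup_type H, h \in K & g = val h.
Proof. by rewrite unfold_in; split=> /asboolP. Qed.

Lemma mem_subgroup_image K (h : subgroup_type H) :
  (val h \in subgroup_image K) = (h \in K).
Proof.
apply/idP/idP=> [/subgroup_imageP[k kK /val_inj->//]|hK].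
by apply/subgroup_imageP; exists h.
Qed.

Fact subgroup_image_mul_closed K : mulg_closed (subgroup_image K).
Proof.
move=> _ _ /subgroup_imageP[g gK ->] /subgroup_imageP[h hK ->].
by rewrite -valM mem_subgroup_image gpredMr.
Qed.

Fact subgroup_image1 K : 1 \in subgroup_image K.
Proof. by apply/subgroup_imageP; exists 1; rewrite ?val1 ?gpred1. Qed.

Fact subgroup_image_inv_closed K : invg_closed (subgroup_image K).
Proof.
move=> _ /subgroup_imageP[g gK ->].
by apply/subgroup_imageP; exists g^-1; rewrite ?gmulfV ?gpredV.
Qed.

HB.instance Definition _ K := isMulClosed.Build _ (subgroup_image K)
  (subgroup_image_mul_closed K).
HB.instance Definition _ K := isMul1Closed.Build _ (subgroup_image K)
  (subgroup_image1 K).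
HB.instance Definition _ K := isInvClosed.Build _ (subgroup_image K)
  (subgroup_image_inv_closed K).

End SubgroupPredicates.

(** * Extension of an [H]-action to [G] *)

Section Extension.
Context {G : groupType} {H : groupClosed G}.
Variables (X : gset (subgroup_type H)) (L : X -> groupClosed G).
Hypothesis L_cover : forall (x : X) (g : G),
  exists2 l, l \in L x & exists h : subgroup_type H, g = l * val h.
Hypothesis L_stab : forall (x : X) (h : subgroup_type H),
  val h \in L x <-> gset_act x h = x.

(* The graph of the extended action; h g = l h' is encoded as h g / h' in L. *)
Definition extends (x : X) (g : G) (y : X) : Prop :=
  exists (h h' : subgroup_type H) (r := orbit_repr X x),
  [/\ x = gset_act r h, y = gset_act r h' & val h * g / val h' \in L r].

(** The extended action stays within each [H]-orbit, so composable instances of [extends] refer to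
    the same [r] and the same [L r]. *)
Lemma extends_repr x g y : extends x g y -> orbit_repr X y = orbit_repr X x.
Proof. by move=> [_ [h' [_ -> _]]]; rewrite orbit_repr_act orbit_repr_id. Qed.

Lemma extends_total x g : exists y, extends x g y.
Proof.
have [h xE] := orbit_reprP X x.
have [l lL [h' e]] := L_cover (orbit_repr X x) (val h * g).
by exists (gset_act (orbit_repr X x) h'), h, h'; split; rewrite // e mulgK.
Qed.

Lemma extends_trans x y z g g' :
  extends x g y -> extends y g' z -> extends x (g * g') z.
Proof.
move=> /[dup]/extends_repr ry [h [h' [xE yE hL]]] [k [k' [yE' zE kL]]].
rewrite ry in yE' zE kL.
exists h, k'; split=> //.
(* The middle point is written both as [r h'] and as [r k]; the discrepancy [h' / k] fixes [r],
   hence lies in [L r] and can be inserted between the two factors. *)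
have /L_stab sL : gset_act (orbit_repr X x) (h' / k) = orbit_repr X x.
  by apply/gset_act_eq; rewrite -yE.
have -> : val h * (g * g') / val k' =
    (val h * g / val h') * val (h' / k) * (val k * g' / val k').
  by rewrite gmulfF !mulgA !mulgVK.
by rewrite gpredMr // gpredMr.
Qed.

Lemma extends_val x (h : subgroup_type H) : extends x (val h) (gset_act x h).
Proof.
have [k xE] := orbit_reprP X x.
exists k, (k * h); split=> //; first by rewrite gset_actM -xE.
by rewrite valM mulgV gpred1.
Qed.

(** Exchanging [h] and [h'] replaces the element of [L r] by its inverse. *)
Lemma extends_sym x y g : extends x g y -> extends y g^-1 x.
Proof.
move=> /[dup]/extends_repr ry [h [h' [xE yE hL]]].
exists h', h; rewrite ry; split=> //.
by rewrite -gpredV !invgM !invgK mulgA.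
Qed.

(** Here [h / h'] lies in both [H] and [L r], so it fixes [r], and [r h = r h']. *)
Lemma extends1 x y : extends x 1 y -> y = x.
Proof.
move=> [h [h' [xE -> hL]]]; rewrite {2}xE; apply/esym/gset_act_eq/L_stab.
by rewrite gmulfF; rewrite mulg1 in hL.
Qed.

(** Going from [y] back to [x] and on to [z] relates [y] to [z] by [g^-1 * g = 1]. This is the
    independence of the choices of [h] and [h']. *)
Lemma extends_fun x g y z : extends x g y -> extends x g z -> y = z.
Proof.
move=> /extends_sym yx xz; apply/esym/extends1.
by rewrite -(mulVg g); exact: extends_trans yx xz.
Qed.

Lemma gset_extension : exists S : gset G, gset_iso X (restr_gset H S).
Proof.
have [a aP] := choice (fun p : X * G => extends_total p.1 p.2).
have aE x g y : extends x g y -> a (x, g) = y.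
  by apply: extends_fun; exact: aP (x, g).
have a_val x h : a (x, val h) = gset_act x h by apply: aE; exact: extends_val.
have a1 x : a (x, 1) = x by rewrite -(val1 (subgroup_type H)) a_val gset_act1.
have aM x g g' : a (x, g * g') = a (a (x, g), g').
  by apply: aE; exact: extends_trans (aP (x, g)) (aP (_, g')).
exists (@GSet G X (fun x g => a (x, g)) a1 aM).
by exists id, id; split=> // x h; rewrite /= /restr_act /= a_val.
Qed.

End Extension.

(** * The two implications of the equivalence *)

Section Supplements.
Context {G : groupType} {H : groupClosed G}.

Lemma supplements_essentially_surjective :
  (forall K : groupClosed G, [set` K] `<=` [set` H] ->
    exists L : groupClosed G,
      [set: G] = [set (l * h)%g | l in [set` L] & h in [set` H]] /\
      [set` L] `&` [set` H] = [set` K]) ->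
  essentially_surjective H.
Proof.
move=> supp X.
have suppX (x : X) : exists L : groupClosed G,
    (forall g, exists2 l, l \in L & exists h : subgroup_type H, g = l * val h) /\
    (forall h : subgroup_type H, val h \in L <-> gset_act x h = x).
  have [|L [GLH LHK]] := supp (subgroup_image (stabilizer X x)).
    by move=> _ /subgroup_imageP[h _ ->]; exact: valP.
  exists L; split=> [g|h].
    have : [set: G] g by [].
    by rewrite GLH => -[l lL [h hH <-]]; exists l => //; exists (Subgroup hH).
  rewrite -stabilizerP -mem_subgroup_image.
  (* Read at a point of [H], the equation for the intersection says that [L] meets [H] in the
     stabilizer of [x]. *)
  have := congr1 (fun A : set G => A (val h)) LHK; rewrite /= => <-.
  by split=> [hL|[]//]; split=> //; exact: valP.
have [L LP] := choice suppX.
by apply: (gset_extension X L) => x; have [] := LP x.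
Qed.

Lemma essentially_surjective_supplement (K : groupClosed G) :
  essentially_surjective H -> [set` K] `<=` [set` H] ->
  exists L : groupClosed G,
    [set: G] = [set (l * h)%g | l in [set` L] & h in [set` H]] /\
    [set` L] `&` [set` H] = [set` K].
Proof.
move=> surj KH.
(* The right cosets of K in H form the orbit of K under right translation. *)
pose A : powerset_gset (G := subgroup_type H) := [set` subgroup_preim K].
pose c : orbit_gset _ A := exist _ A (orbit_refl _ A).
have [S [f [f' [fE _ fK f'K]]]] := surj (orbit_gset _ A).
pose s : S := f c.
have sE (h : subgroup_type H) : gset_act s (val h) = f (gset_act c h).
  by rewrite fE.
(* As [f] is injective and equivariant, [s] and the trivial coset [c] have the same stabilizer in
   [H]. *)
have stabE (h : subgroup_type H) : val h \in stabilizer S s <-> val h \in K.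
  rewrite stabilizerP sE; split=> [/(can_inj fK)/(congr1 sval)/=|hK].
    by move=> /translate_group.
  by congr f; apply: orbit_sval_inj => /=; apply/translate_group.
exists (stabilizer S s : groupClosed G); split; apply/seteqP; split=> g //.
- move=> _.
  (* Every coset is a translate of [c] and [f] is onto, so [H] is already transitive on [S]. Hence
     [g] factors as [g / val h], which fixes [s], times [val h]. *)
  have [h hE] : exists h : subgroup_type H, gset_act s g = gset_act s (val h).
    have [h hE] := svalP (f' (gset_act s g)); exists h.
    rewrite sE -[LHS]f'K; congr f; exact: orbit_sval_inj.
  exists (g / val h); first by apply/stabilizerP/gset_act_eq.
  by exists (val h); [exact: valP | rewrite mulgVK].
- by move=> [gL gH]; exact/(stabE (Subgroup gH)).
- by move=> gK; have gH := KH _ gK; split=> //; exact/(stabE (Subgroup gH)).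
Qed.

End Supplements.

Theorem proposition6p1 (G : groupType) (H : groupClosed G) :
  essentially_surjective H <->
  (forall K : groupClosed G, [set` K] `<=` [set` H] ->
    exists L : groupClosed G,
      [set: G] = [set (l * h)%g | l in [set` L] & h in [set` H]] /\
      [set` L] `&` [set` H] = [set` K]).
Proof.
split; last exact: supplements_essentially_surjective.
by move=> surj K; exact: essentially_surjective_supplement.
Qed.
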